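(* Let $p\ge 5$ be a prime, $m\ge 1$ an integer, and $q=p^m$ with $q\equiv 2\pmod 3$. Let $(u_i,v_i)\to(u_{i+1},v_{i+1})$ be an AGM update edge, i.e. $(u_i,v_i),(u_{i+1},v_{i+1})\in V_{\mathrm{AGM}}$ satisfy $$u_{i+1}=\frac{u_i+2v_i}{3},\qquad v_{i+1}^3=\frac{v_i(u_i^2+u_iv_i+v_i^2)}{3}.$$ Set $\rho_j:=u_j/v_j$ and let $H_{\rho_j}$ be the Hessian curve $X^3+Y^3+Z^3=3\rho_jXYZ$ for $j=i,i+1$, and define $$A_i:=9(\rho_i^2+\rho_i+1),\qquad D_i:=3(\rho_i+2),\qquad \eta_i:=\frac{3v_{i+1}}{v_i}\in\mathbb{F}_q^\times.$$ Then $$\eta_i^3=A_i,\qquad \frac{D_i}{\eta_i}=3\rho_{i+1}.$$ Moreover, the map $$\phi_i:H_{\rho_i}\longrightarrow H_{\rho_{i+1}},\qquad (X:Y:Z)\longmapsto\bigl(\eta_iXYZ:\ X^2Z+XY^2+YZ^2:\ X^2Y+XZ^2+Y^2Z\bigr)$$ is a $3$-isogeny (over $\mathbb{F}_q$).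
   Context: $V_{\mathrm{AGM}}:=\{(u,v)\in\mathbb{F}_q^2\mid v\ne 0,\ u^3\ne v^3\}$. For $d\in\mathbb{F}_q$ with $d^3\ne 27$, the projective plane curve $X^3+Y^3+Z^3=dXYZ$ over $\mathbb{F}_q$ is nonsingular and is regarded as an elliptic curve with identity $O=(0:-1:1)$; it is called a Hessian curve. For $(u,v)\in V_{\mathrm{AGM}}$ and $\rho=u/v$, the curve $H_\rho$ with $d=3\rho$ is such a curve. An isogeny over $\mathbb{F}_q$ between elliptic curves over $\mathbb{F}_q$ is a nonconstant morphism of curves defined over $\mathbb{F}_q$ sending identity to identity; its degree is the degree of the induced function field extension. A $3$-isogeny is an isogeny over $\mathbb{F}_q$ of degree $3$. *)

(* Defs.v *)
From HB Require Import structures.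
From mathcomp Require Import all_boot all_order all_algebra all_field.
From mathcomp Require Import mpoly.
From mathcomp Require Import ring zify.

Set Implicit Arguments.
Unset Strict Implicit.
Unset Printing Implicit Defensive.

Import GRing.Theory.
Local Open Scope ring_scope.

Definition V_AGM (F : fieldType) (w : F * F) : Prop :=
  w.2 != 0 /\ w.1 ^+ 3 != w.2 ^+ 3.

Definition AGM_edge (F : fieldType) (w w' : F * F) : Prop :=
  [/\ V_AGM w, V_AGM w',
      w'.1 = (w.1 + 2%:R * w.2) / 3%:R
    & w'.2 ^+ 3 = w.2 * (w.1 ^+ 2 + w.1 * w.2 + w.2 ^+ 2) / 3%:R].

(* The curve X ^ 3 + Y ^ 3 + Z ^ 3 = d X Y Z, represented by its coefficient d. *)
Record hessian_curve (F : fieldType) := HessianCurve {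
  hcoef : F;
  hcoefP : hcoef ^+ 3 != 27%:R
}.

Definition iX : 'I_3 := @Ordinal 3 0 isT.
Definition iY : 'I_3 := @Ordinal 3 1 isT.
Definition iZ : 'I_3 := @Ordinal 3 2 isT.

Definition proj_coords (L : fieldType) (P : 3.-tuple L) : Prop :=
  exists i, tnth P i != 0.

Definition proj_eq (L : fieldType) (P Q : 3.-tuple L) : Prop :=
  forall i j, tnth P i * tnth Q j = tnth P j * tnth Q i.

Definition form_triple (F : fieldType) := (3.-tuple {mpoly F[3]})%type.

Definition homog_triple (F : fieldType) (f : form_triple F) : Prop :=
  exists e : nat, forall i, tnth f i \is e.-homog.

Definition eval_triple (F : fieldType) (f : form_triple F) (P : 3.-tuple F) :
  3.-tuple F := [tuple (tnth f i).@[tnth P] | i < 3].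

Definition base_change (F L : fieldType) (iota : {rmorphism F -> L})
  (f : form_triple F) : form_triple L :=
  [tuple map_mpoly iota (tnth f i) | i < 3].

Definition hessian_form (F : fieldType) (d : F) : {mpoly F[3]} :=
  'X_iX ^+ 3 + 'X_iY ^+ 3 + 'X_iZ ^+ 3 - d *: ('X_iX * 'X_iY * 'X_iZ).

Definition on_curve (F L : fieldType) (iota : {rmorphism F -> L})
  (H : hessian_curve F) (P : 3.-tuple L) : Prop :=
  proj_coords P /\ (hessian_form (iota (hcoef H))).@[tnth P] = 0.

Definition hessian_origin (F : fieldType) : 3.-tuple F := [tuple 0; - 1; 1].

(* [hessian_form d] is irreducible over every field when d ^ 3 <> 27, so the
   principal ideal it generates is the homogeneous ideal of the curve. *)
Definition in_curve_ideal (F : fieldType) (d : F) (p : {mpoly F[3]}) : Prop :=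
  exists q, p = q * hessian_form d.

(* Rational maps and morphisms between plane curves, given by triples of forms
    of equal degree modulo the ideal of the source curve (Silverman,
    The Arithmetic of Elliptic Curves, I.3). *)

Definition same_map (F : fieldType) (d : F) (f g : form_triple F) : Prop :=
  forall i j, in_curve_ideal d (tnth f i * tnth g j - tnth f j * tnth g i).

Definition is_rational_map (F : fieldType) (H1 H2 : hessian_curve F)
  (f : form_triple F) : Prop :=
  [/\ homog_triple f,
      exists i, ~ in_curve_ideal (hcoef H1) (tnth f i)
    & in_curve_ideal (hcoef H1) (hessian_form (hcoef H2) \mPo f)].

(* The value at P may be computed with any triple [g] that represents the same
   rational map and does not vanish at P. *)
Definition maps_to (F L : fieldType) (iota : {rmorphism F -> L})
  (H1 : hessian_curve F) (f : form_triple F) (P Q : 3.-tuple L) : Prop :=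
  exists g : form_triple L,
    [/\ homog_triple g, same_map (iota (hcoef H1)) (base_change iota f) g,
        proj_coords (eval_triple g P) & proj_eq (eval_triple g P) Q].

(* Regularity is required at the points over all extension fields of F, in
   particular at the geometric points. *)
Definition is_morphism (F : fieldType) (H1 H2 : hessian_curve F)
  (f : form_triple F) : Prop :=
  is_rational_map H1 H2 f /\
  forall (L : fieldType) (iota : {rmorphism F -> L}) (P : 3.-tuple L),
    on_curve iota H1 P ->
    exists Q, on_curve iota H2 Q /\ maps_to iota H1 f P Q.

Definition nonconstant (F : fieldType) (H1 : hessian_curve F)
  (f : form_triple F) : Prop :=
  forall (L : fieldType) (iota : {rmorphism F -> L}) (c : 3.-tuple L),
    proj_coords c ->
    ~ same_map (iota (hcoef H1)) (base_change iota f) [tuple (tnth c i)%:MP | i < 3].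

(* The formula [f] itself can be evaluated at every point of the curve. *)
Definition everywhere_defined (F : fieldType) (H1 : hessian_curve F)
  (f : form_triple F) : Prop :=
  forall (L : fieldType) (iota : {rmorphism F -> L}) (P : 3.-tuple L),
    on_curve iota H1 P -> proj_coords (eval_triple (base_change iota f) P).

(* The affine chart Z = 1 of the curve, as a polynomial in y over F(x). *)
Definition hessian_affine (F : fieldType) (d : F) :
  {poly {fraction {poly F}}} :=
  'X^3 - tofrac (d *: 'X) *: 'X + (tofrac ('X^3 + 1))%:P.

Section FractionRepr.
Local Open Scope quotient_scope.

Lemma fraction_numden (R : idomainType) (x : {fraction R}) :
  exists n m : R, m != 0 /\ x = tofrac n / tofrac m.
Proof.
elim/quotW: x => x; exists (frac x).1, (frac x).2.
split; first exact: denom_ratioP.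
rewrite -[X in \pi X]Ratio_numden; unlock tofrac.
rewrite -[X in _ = _ * X]FracField.pi_inv -[RHS]FracField.pi_mul.
rewrite /FracField.invf /FracField.mulf.
by rewrite !numden_Ratio ?oner_eq0 ?denom_ratioP // mulr1 mul1r.
Qed.

End FractionRepr.

Lemma size_hessian_affine (F : fieldType) (d : F) :
  size (hessian_affine d) = 4 /\ hessian_affine d \is monic.
Proof.
have s : (size (- (tofrac (d *: 'X) *: 'X) +
                (tofrac ('X^3 + 1 : {poly F}))%:P)%R < 4)%N.
  rewrite (leq_ltn_trans (size_polyD _ _)) // gtn_max size_polyN.
  rewrite (leq_ltn_trans (size_scale_leq _ _)) ?size_polyX //=.
  by rewrite (leq_ltn_trans (size_polyC_leq1 _)).
rewrite /hessian_affine -addrA; split.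
  by rewrite size_polyDl size_polyXn.
by rewrite monicE lead_coefDl ?size_polyXn // lead_coefXn.
Qed.

Lemma no_poly_root (F : fieldType) (d : F) (r : {poly F}) :
  r ^+ 3 - d *: 'X * r + ('X^3 + 1) = 0 -> d ^+ 3 = 27%:R.
Proof.
move=> e.
have s2 : (size r <= 2)%N.
  rewrite leqNgt; apply/negP => s3.
  have e1 : r ^+ 3 = d *: ('X * r) - ('X^3 + 1).
    by apply/eqP; rewrite -subr_eq0 -e -!mul_polyC; apply/eqP; ring.
  have := size_exp r 3; rewrite e1 => e2.
  have : (size (d *: ('X * r) - ('X^3 + 1))%R <= maxn (size r).+1 4)%N.
    rewrite (leq_trans (size_polyD _ _)) // geq_max size_polyN.
    rewrite size_polyDl ?size_polyXn ?size_poly1 // leq_maxr andbT.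
    rewrite (leq_trans (size_scale_leq _ _)) //.
    rewrite (leq_trans (size_polyMleq _ _)) // size_polyX /=.
    by rewrite leq_maxl.
  move: e2 s3; move: (size (d *: ('X * r) - ('X^3 + 1))%R) (size r) => a b.
  lia.
have er : r = (r`_0)%:P + r`_1 *: 'X.
  apply/polyP => -[|[|i]]; rewrite !coefE /= ?mulr0 ?mulr1 ?addr0 ?add0r //.
  by rewrite nth_default // (leq_trans s2).
move: er e; move: r`_0 r`_1 => b a -> e.
have {}e : (a ^+ 3 + 1) *: 'X^3 + (3%:R * a ^+ 2 * b - d * a) *: 'X^2
    + (3%:R * a * b ^+ 2 - d * b) *: 'X + (b ^+ 3 + 1)%:P = 0.
  rewrite -[RHS]e -!mul_polyC; ring.
have := congr1 (fun p : {poly F} => p`_3) e.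
have := congr1 (fun p : {poly F} => p`_2) e.
have := congr1 (fun p : {poly F} => p`_0) e.
rewrite !coefE /= !(mulr0, mulr1, addr0, add0r) => eb e2 ea.
have a0 : a != 0.
  by apply: contra_eq_neq ea => ->; rewrite expr0n add0r oner_neq0.
have ed : d = 3%:R * a * b.
  apply: (mulIf a0); apply/esym/eqP; rewrite -subr_eq0 -e2; apply/eqP; ring.
have ea3 : a ^+ 3 = - 1 by apply/eqP; rewrite -subr_eq0 opprK ea.
have eb3 : b ^+ 3 = - 1 by apply/eqP; rewrite -subr_eq0 opprK eb.
by rewrite ed !exprMn ea3 eb3; ring.
Qed.

Lemma cancel_right (K : fieldType) (a b g : K) :
  g != 0 -> a * g / (b * g) = a / b.
Proof. by move=> g0; rewrite -mulf_div divff // mulr1. Qed.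

Lemma clear_denominators (R : idomainType) (K : fieldType)
    (f : {rmorphism R -> K}) (a b u w : R) : f b != 0 ->
  f (a ^+ 3 - u * a * b ^+ 2 + w * b ^+ 3)
    = f b ^+ 3 * ((f a / f b) ^+ 3 - f u * (f a / f b) + f w).
Proof. by move=> b0; field. Qed.

Lemma horner_hessian_affine (F : fieldType) (d : F) (x : {fraction {poly F}}) :
  (hessian_affine d).[x]
    = x ^+ 3 - tofrac (d *: 'X) * x + tofrac ('X^3 + 1).
Proof. by rewrite /hessian_affine !hornerE. Qed.

Lemma hessian_affine_irreducible (F : fieldType) (H : hessian_curve F) :
  monic_irreducible_poly (hessian_affine (hcoef H)).
Proof.
case: H => d /= hd; have [sz mon] := size_hessian_affine d.
split=> //; apply: cubic_irreducible; first by rewrite sz.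
move=> x; apply/negP => /rootP.
have [n [m [m0 ->]]] := fraction_numden x.
pose g := gcdp n m; pose a := n %/ g; pose b := m %/ g.
have g0 : g != 0 by rewrite gcdp_eq0 negb_and m0 orbT.
have en : n = a * g by rewrite divpK // dvdp_gcdl.
have em : m = b * g by rewrite divpK // dvdp_gcdr.
have cop : coprimep a b by apply: coprimep_div_gcd; rewrite m0 orbT.
clearbody a b g.
have b0 : b != 0 by move: m0; rewrite em mulf_eq0 negb_or => /andP[].
have fb0 : tofrac b != 0 by rewrite tofrac_eq0.
have -> : tofrac n / tofrac m = tofrac a / tofrac b.
  rewrite en em rmorphM rmorphM.
  by apply: cancel_right; rewrite tofrac_eq0.
rewrite horner_hessian_affine => e.
have e1 : a ^+ 3 - d *: 'X * a * b ^+ 2 + ('X^3 + 1) * b ^+ 3 = 0.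
  apply/eqP; rewrite -tofrac_eq0; apply/eqP.
  by rewrite clear_denominators // e mulr0.
have ba : b %| a ^+ 3.
  have -> : a ^+ 3 = (d *: 'X * a * b - ('X^3 + 1) * b ^+ 2) * b.
    by apply/eqP; rewrite -subr_eq0 -e1; apply/eqP; ring.
  exact: dvdp_mull.
have /size_poly1P[c c0 eb] : size b == 1%N.
  by rewrite -coprimepp; apply: (coprimep_dvdl ba); rewrite coprimep_expr // coprimep_sym.
move/eqP: hd; apply; apply: (@no_poly_root _ _ (c^-1 *: a)).
have cc : (c^-1)%:P * c%:P = 1 :> {poly F} by rewrite -polyCM mulVf.
have -> : c^-1 *: a = (c^-1)%:P * a by rewrite mul_polyC.
move: e1; rewrite eb; move: cc; set k := (c^-1)%:P => cc e1.
rewrite -[RHS](mulr0 (k ^+ 3)) -e1.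
have -> : k ^+ 3 * (a ^+ 3 - d *: 'X * a * c%:P ^+ 2 + ('X^3 + 1) * c%:P ^+ 3)
  = (k * a) ^+ 3 - d *: 'X * (k * a) * (k * c%:P) ^+ 2
     + ('X^3 + 1) * (k * c%:P) ^+ 3 by ring.
by rewrite cc !expr1n !mulr1.
Qed.

(* The function field F(x, y) with x ^ 3 + y ^ 3 + 1 = d x y. *)
Definition function_field (F : fieldType) (H : hessian_curve F) : fieldType :=
  {poly %/ (hessian_affine (hcoef H)) with (hessian_affine_irreducible H)}.

Section FunctionField.
Variables (F : fieldType) (H : hessian_curve F).

Definition ff_const : {rmorphism F -> function_field H} :=
  GRing.in_alg {poly %/ (hessian_affine (hcoef H))
                  with (hessian_affine_irreducible H)}
    \o @tofrac {poly F} \o polyC.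

Definition ff_x : function_field H :=
  in_qpoly (hessian_affine (hcoef H)) (tofrac 'X)%:P.

Definition ff_y : function_field H :=
  in_qpoly (hessian_affine (hcoef H)) 'X.

Definition generic_point : 3.-tuple (function_field H) := [tuple ff_x; ff_y; 1].

End FunctionField.

(* [f] is composition of rational functions with the rational map given by the
   forms [phi]; it is determined by the images of x and y, which are read off by
   evaluating [phi] at the generic point of the source curve. *)
Definition is_pullback (F : fieldType) (H1 H2 : hessian_curve F)
  (phi : form_triple F)
  (f : {rmorphism function_field H2 -> function_field H1}) : Prop :=
  let Q := eval_triple (base_change (ff_const H1) phi) (generic_point H1) in
  [/\ forall c, f (ff_const H2 c) = ff_const H1 c,
      tnth Q iZ != 0,
      f (ff_x H2) = tnth Q iX / tnth Q iZ
    & f (ff_y H2) = tnth Q iY / tnth Q iZ].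

(* [L : f(K)] = n.  The library's [fieldExtType] needs a canonical vector space
   structure over the base, so the degree along a morphism is stated by a basis. *)
Definition extension_degree (K L : fieldType) (f : {rmorphism K -> L})
  (n : nat) : Prop :=
  exists b : 'I_n -> L,
    forall x : L, exists! c : {ffun 'I_n -> K}, x = \sum_i f (c i) * b i.

Definition has_degree (F : fieldType) (H1 H2 : hessian_curve F)
  (phi : form_triple F) (n : nat) : Prop :=
  exists f : {rmorphism function_field H2 -> function_field H1},
    is_pullback phi f /\ extension_degree f n.

Definition is_isogeny (F : fieldType) (H1 H2 : hessian_curve F)
  (phi : form_triple F) : Prop :=
  [/\ is_morphism H1 H2 phi, nonconstant H1 phi
    & maps_to idfun H1 phi (hessian_origin F) (hessian_origin F)].

Definition is_n_isogeny (n : nat) (F : fieldType) (H1 H2 : hessian_curve F)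
  (phi : form_triple F) : Prop :=
  is_isogeny H1 H2 phi /\ has_degree H1 H2 phi n.

Definition AGM_map (F : fieldType) (eta : F) : form_triple F :=
  let X := 'X_iX in let Y := 'X_iY in let Z := 'X_iZ in
  [tuple eta *: (X * Y * Z);
         X ^+ 2 * Z + X * Y ^+ 2 + Y * Z ^+ 2;
         X ^+ 2 * Y + X * Z ^+ 2 + Y ^+ 2 * Z].

(* Main.v *)
(* Write t1 = X/Z, t2 = Y/X, t3 = Z/Y.  The cyclic substitution X -> Y -> Z -> X
   permutes the t_i and fixes the coordinates of phi, since their ratios are
   the elementary symmetric functions of the t_i: with (xi, ups) the affine
   coordinates of the image point, t1, t2, t3 are the roots of
     T ^ 3 - (eta / xi) T ^ 2 + (eta ups / xi) T - 1.
   This cubic is irreducible over the pulled back function field, because that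
   field is fixed by the substitution while the t_i are distinct, and its root
   t1 = x generates the function field of the source: the equation of the curve
   reads t1/t2 + t2/t3 + t3/t1 = d and becomes linear in t2 once t2 + t3 and
   t2 t3 are known.  Hence the degree is 3. *)
Require Import Defs.
From HB Require Import structures.
From mathcomp Require Import all_boot all_order all_algebra all_field.
From mathcomp Require Import mpoly.
From mathcomp Require Import ring.

Set Implicit Arguments.
Unset Strict Implicit.
Unset Printing Implicit Defensive.

Import GRing.Theory.
Local Open Scope ring_scope.

(** * Universal properties *)

Section FractionLift.
Variables (R : idomainType) (K : fieldType) (f : {rmorphism R -> K}).
Hypothesis f_inj : injective f.

Fact fraction_repr_exists (x : {fraction R}) :
  exists r : R * R, (r.2 != 0) && (x == tofrac r.1 / tofrac r.2).
Proof.
by have [n [m [m0 ->]]] := fraction_numden x; exists (n, m); rewrite m0 eqxx.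
Qed.

(** The numerator and denominator come from [xchoose], so the value does not compute;
    [fraction_lift_div] shows that every other representative gives the same value. *)
Definition fraction_lift (x : {fraction R}) : K :=
  let r := xchoose (fraction_repr_exists x) in f r.1 / f r.2.

Let f_neq0 (c : R) : c != 0 -> f c != 0.
Proof. by move=> c0; rewrite -(rmorph0 f) (inj_eq f_inj). Qed.

Lemma fraction_lift_div (a b : R) :
  b != 0 -> fraction_lift (tofrac a / tofrac b) = f a / f b.
Proof.
move=> b0; rewrite /fraction_lift.
have /andP[] := xchooseP (fraction_repr_exists (tofrac a / tofrac b)).
move: (xchoose _) => [n m] /= m0.
rewrite eqr_div ?tofrac_eq0 // -!rmorphM tofrac_eq => /eqP e.
by apply/eqP; rewrite eqr_div ?f_neq0 // -!rmorphM e mulrC.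
Qed.

Lemma fraction_lift_tofrac (a : R) : fraction_lift (tofrac a) = f a.
Proof.
by rewrite -[tofrac a]divr1 -tofrac1 fraction_lift_div ?oner_eq0 // rmorph1 divr1.
Qed.

Fact fraction_lift_is_zmod_morphism : zmod_morphism fraction_lift.
Proof.
move=> x y; have [a [b [b0 ->]]] := fraction_numden x.
have [c [d [d0 ->]]] := fraction_numden y.
rewrite -mulNr addf_div ?tofrac_eq0 // -!(rmorphM, rmorphN, rmorphD).
rewrite !fraction_lift_div ?mulf_neq0 //.
by rewrite -mulNr addf_div ?f_neq0 // !(rmorphM, rmorphN, rmorphD).
Qed.

Fact fraction_lift_is_monoid_morphism : monoid_morphism fraction_lift.
Proof.
split=> [|x y]; first by rewrite -tofrac1 fraction_lift_tofrac rmorph1.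
have [a [b [b0 ->]]] := fraction_numden x.
have [c [d [d0 ->]]] := fraction_numden y.
rewrite mulf_div -!rmorphM !fraction_lift_div ?mulf_neq0 //.
by rewrite !rmorphM mulf_div.
Qed.

HB.instance Definition _ := GRing.isZmodMorphism.Build {fraction R} K
  fraction_lift fraction_lift_is_zmod_morphism.
HB.instance Definition _ := GRing.isMonoidMorphism.Build {fraction R} K
  fraction_lift fraction_lift_is_monoid_morphism.

Lemma fraction_universal :
  exists g : {rmorphism {fraction R} -> K}, forall a, g (tofrac a) = f a.
Proof. by exists fraction_lift; apply: fraction_lift_tofrac. Qed.

End FractionLift.

Section QuotientLift.
Variables (K L : fieldType) (h : {poly K}) (hI : monic_irreducible_poly h).
Variables (f : {rmorphism K -> L}) (z : L).
Hypothesis hz : root (map_poly f h) z.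

Definition qfpoly_lift (p : {poly %/ h with hI}) : L :=
  (map_poly f (val (p : {poly %/ h}))).[z].

(** Reduction changes [p] by a multiple of [h], which dies at [z]. Hence sums and products may be
    evaluated before they are reduced. *)
Lemma qfpoly_lift_in (p : {poly K}) :
  qfpoly_lift (in_qpoly h p) = (map_poly f p).[z].
Proof.
rewrite /qfpoly_lift /in_qpoly /= mk_monicE //.
rewrite [in RHS](Pdiv.RingMonic.rdivp_eq (snd hI) p).
by rewrite rmorphD rmorphM /= hornerD hornerM (rootP hz) mulr0 add0r.
Qed.

Lemma qfpoly_in_val (p : {poly %/ h with hI}) :
  p = in_qpoly h (val (p : {poly %/ h})).
Proof.
by apply: val_inj; rewrite /= Pdiv.Ring.rmodp_small // size_mk_monic.
Qed.

Fact qfpoly_lift_is_zmod_morphism : zmod_morphism qfpoly_lift.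
Proof. by move=> p q; rewrite /qfpoly_lift /= rmorphB /= hornerD hornerN. Qed.

Fact qfpoly_lift_is_monoid_morphism : monoid_morphism qfpoly_lift.
Proof.
split=> [|p q].
  by rewrite -[1](in_qpoly1 h) qfpoly_lift_in rmorph1 hornerC.
rewrite {1}(qfpoly_in_val p) {1}(qfpoly_in_val q).
have -> : in_qpoly h (val (p : {poly %/ h})) * in_qpoly h (val (q : {poly %/ h}))
  = in_qpoly h (val (p : {poly %/ h}) * val (q : {poly %/ h})) by rewrite rmorphM.
by rewrite qfpoly_lift_in rmorphM /= hornerM.
Qed.

HB.instance Definition _ := GRing.isZmodMorphism.Build {poly %/ h with hI} L
  qfpoly_lift qfpoly_lift_is_zmod_morphism.
HB.instance Definition _ := GRing.isMonoidMorphism.Build {poly %/ h with hI} L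
  qfpoly_lift qfpoly_lift_is_monoid_morphism.

Lemma qfpoly_universal :
  exists g : {rmorphism {poly %/ h with hI} -> L},
    forall p, g (in_qpoly h p) = (map_poly f p).[z].
Proof. by exists qfpoly_lift; apply: qfpoly_lift_in. Qed.

End QuotientLift.

(** * Function fields of Hessian curves *)

Lemma tofrac_inj (R : idomainType) : injective (@tofrac R).
Proof. by move=> a b /eqP; rewrite tofrac_eq => /eqP. Qed.

(* Clearing denominators in [p (ev A / ev B) = 0] gives a relation between
   polynomials, whose value at (x0, y0) is [p (0)] times a power of [B (x0, y0)]. *)
Lemma transcendental_quotient (F L : fieldType) (iota : {rmorphism F -> L})
    (ev : {rmorphism {poly {poly F}} -> L}) (x0 y0 : F) (A B : {poly {poly F}})
    (p : {poly F}) :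
    (forall c, ev c%:P%:P = iota c) ->
    (forall G, ev G = 0 -> G.[y0%:P].[x0] = 0) ->
    A.[y0%:P].[x0] = 0 -> B.[y0%:P].[x0] != 0 -> ev A != 0 ->
  (map_poly iota p).[ev A / ev B] = 0 -> p = 0.
Proof.
move=> evC spec A0 B0 nzA; set z := _ / _.
have nzB : ev B != 0 by apply: contra_neq B0; apply: spec.
have homogenize (r : {poly F}) : exists n G,
    ev G = (map_poly (iota) r).[z] * ev B ^+ n
    /\ G.[y0%:P].[x0] = r.[0] * B.[y0%:P].[x0] ^+ n.
  elim/poly_ind: r => [|r c [n [G [eG G0]]]].
    by exists 0, 0; rewrite !rmorph0 !horner0 !mul0r.
  exists n.+1, (G * A + c%:P%:P * B ^+ n.+1); split.
    rewrite rmorphD !rmorphM rmorphXn evC eG rmorphD rmorphM /=.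
    rewrite map_polyX map_polyC !hornerE /= /z exprS.
    by field.
  by rewrite !hornerE /= A0 ?mulr0 ?add0r; ring.
elim/poly_ind: p => [//|r c IHr] e.
have c0 : c = 0.
  have [n [G [eG G0]]] := homogenize (r * 'X + c%:P).
  move: eG; rewrite e mul0r => /spec; rewrite G0 !hornerE.
  by move/eqP; rewrite mulf_eq0 expf_eq0 (negPf B0) andbF orbF => /eqP.
(* The polynomial is now [r * 'X], and [z] is nonzero, so [r] vanishes at [z] as well and induction
   applies. *)
move: e; rewrite c0 polyC0 addr0 rmorphM /= map_polyX hornerM hornerX => /eqP.
rewrite mulf_eq0 => /orP[/eqP/IHr r0|]; first by rewrite r0 mul0r.
by rewrite mulf_eq0 invr_eq0 (negPf nzA) (negPf nzB).
Qed.

Section FunctionFieldTheory.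
Variables (F : fieldType) (H : hessian_curve F).
Local Notation d := (hcoef H).
Local Notation K := (function_field H).
Local Notation irr := (hessian_affine_irreducible H).

Definition ff_proj : {rmorphism {poly {fraction {poly F}}} -> K} :=
  in_qpoly (hessian_affine d)
    : {rmorphism _ -> {poly %/ (hessian_affine d) with irr}}.

(** The inner variable goes to [ff_x] and the outer one to [ff_y]. Working in F[x][y] keeps
    functions free of denominators, so they can be evaluated at points. *)
Definition ff_eval : {rmorphism {poly {poly F}} -> K} :=
  ff_proj \o map_poly (@tofrac {poly F}).

Definition ff_ratfun : {rmorphism {fraction {poly F}} -> K} := ff_proj \o polyC.

Lemma ff_evalX : ff_eval ('X%:P) = ff_x H.
Proof. by rewrite /ff_eval /ff_x /= map_polyC. Qed.

Lemma ff_evalY : ff_eval 'X = ff_y H.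
Proof. by rewrite /ff_eval /ff_y /= map_polyX. Qed.

Lemma ff_constE (c : F) : ff_const H c = ff_ratfun (tofrac c%:P).
Proof.
rewrite /ff_const /= /GRing.in_alg -[1](rmorph1 ff_proj) /=.
by apply: val_inj; rewrite /= -Pdiv.RingMonic.rmodpZ ?monic_mk_monic // alg_polyC.
Qed.

Lemma ff_evalC (c : F) : ff_eval c%:P%:P = ff_const H c.
Proof. by rewrite ff_constE /ff_eval /= map_polyC. Qed.

(** The cubic [hessian_affine] before passing to fractions. It is monic in y, so division by it
    stays inside F[x][y]. *)
Definition hessian_affine_poly : {poly {poly F}} :=
  'X^3 - (d *: 'X)%:P * 'X + ('X^3 + 1)%:P.

Lemma map_hessian_affine_poly :
  map_poly (@tofrac {poly F}) hessian_affine_poly = hessian_affine d.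
Proof.
rewrite /hessian_affine_poly /hessian_affine.
rewrite rmorphD rmorphB rmorphXn rmorphM /= map_polyX !map_polyC.
by rewrite -(mul_polyC (tofrac _)).
Qed.

Lemma hessian_affine_poly_monic : hessian_affine_poly \is monic.
Proof.
have := (size_hessian_affine d).2; rewrite -map_hessian_affine_poly !monicE.
rewrite lead_coef_map_inj ?rmorph0 //; last exact: tofrac_inj.
by rewrite -tofrac1 tofrac_eq.
Qed.

Lemma size_hessian_affine_poly : size hessian_affine_poly = 4%N.
Proof.
rewrite -[RHS](size_hessian_affine d).1 -map_hessian_affine_poly.
rewrite size_map_inj_poly ?rmorph0 //; exact: tofrac_inj.
Qed.

Lemma ff_eval_small_eq0 (G : {poly {poly F}}) :
  (size G < 4)%N -> ff_eval G = 0 -> G = 0.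
Proof.
move=> sG /(congr1 val) /=; rewrite (mk_monicE irr) => e.
have stG : size (map_poly (@tofrac {poly F}) G) = size G.
  by rewrite size_map_inj_poly ?rmorph0 //; exact: tofrac_inj.
move: e; rewrite Pdiv.Ring.rmodp_small.
  move=> e; apply: (map_inj_poly (@tofrac_inj _)); rewrite ?rmorph0 //.
by rewrite stG (size_hessian_affine d).1.
Qed.

Lemma ff_eval_hessian : ff_eval hessian_affine_poly = 0.
Proof.
apply: val_inj; rewrite /= map_hessian_affine_poly (mk_monicE irr).
exact: Pdiv.RingMonic.rmodpp (size_hessian_affine d).2.
Qed.

(** The remainder of [G] modulo the monic cubic has y-degree below 3 and the same value, so it is
    zero: 1, y, y^2 are independent over F(x). *)
Lemma ff_eval_eq0 (G : {poly {poly F}}) :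
  ff_eval G = 0 -> exists q, G = q * hessian_affine_poly.
Proof.
move=> eG; exists (Pdiv.Ring.rdivp G hessian_affine_poly).
have eqG := Pdiv.RingMonic.rdivp_eq hessian_affine_poly_monic G.
rewrite {1}eqG -[RHS]addr0; congr (_ + _); apply: ff_eval_small_eq0.
  rewrite -size_hessian_affine_poly Pdiv.Ring.ltn_rmodp monic_neq0 //.
  exact: hessian_affine_poly_monic.
by move: eG; rewrite {1}eqG rmorphD rmorphM ff_eval_hessian mulr0 add0r.
Qed.

Lemma ff_relation :
  ff_x H ^+ 3 + ff_y H ^+ 3 + 1 = ff_const H d * ff_x H * ff_y H.
Proof.
have e : hessian_affine_poly
    = 'X%:P ^+ 3 + 'X ^+ 3 + 1 - d%:P%:P * 'X%:P * 'X.
  by rewrite /hessian_affine_poly -mul_polyC polyCD polyCM polyC_exp; ring.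
apply/eqP; rewrite -subr_eq0 -ff_eval_hessian e rmorphB !rmorphM !rmorphD.
by rewrite !rmorphXn rmorph1 ff_evalC ff_evalX ff_evalY.
Qed.

(** The constants, x and y generate the function field: an element is a polynomial in y over F(x),
    and inverses enter through the denominators in F[x]. *)
Lemma ff_ind (P : K -> Prop) :
    (forall c, P (ff_const H c)) -> P (ff_x H) -> P (ff_y H) ->
    (forall a b, P a -> P b -> P (a + b)) ->
    (forall a b, P a -> P b -> P (a * b)) ->
    (forall a, P a -> P a^-1) ->
  forall a, P a.
Proof.
move=> Pc Px Py PD PM PV a.
have Ptf (r : {poly F}) : P (ff_ratfun (tofrac r)).
  elim/poly_ind: r => [|r c IHr].
    have -> : ff_ratfun (tofrac 0) = ff_const H 0 by rewrite !rmorph0.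
    exact: Pc.
  rewrite tofracD tofracM rmorphD rmorphM -ff_constE.
  exact: PD (PM _ _ IHr Px) (Pc c).
have Pfrac (r : {fraction {poly F}}) : P (ff_ratfun r).
  have [n [m [m0 ->]]] := fraction_numden r.
  rewrite rmorphM fmorphV.
  exact: PM (Ptf n) (PV _ (Ptf m)).
rewrite (qfpoly_in_val a); move: (val _) => G.
rewrite -[in_qpoly _ _]/(ff_proj G).
elim/poly_ind: G => [|G c IHG].
  have -> : ff_proj 0 = ff_const H 0 by rewrite !rmorph0.
  exact: Pc.
rewrite rmorphD rmorphM.
exact: PD (PM _ _ IHG Py) (Pfrac c).
Qed.

End FunctionFieldTheory.

(** * Specialization at affine points and morphisms out of the function field *)

Section FunctionFieldMorphisms.
Variables (F : fieldType) (H : hessian_curve F).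
Local Notation d := (hcoef H).
Local Notation K := (function_field H).

Section Specialization.
Variables x0 y0 : F.
Hypothesis on_affine : x0 ^+ 3 + y0 ^+ 3 + 1 = d * x0 * y0.

(** A relation at the generic point is a multiple of the curve equation, so it persists at every
    rational affine point. Read contrapositively, one point with a nonzero value shows that a
    function is nonzero. *)
Lemma ff_eval_specialize (G : {poly {poly F}}) :
  ff_eval H G = 0 -> G.[y0%:P].[x0] = 0.
Proof.
move=> /ff_eval_eq0 [q ->]; rewrite /hessian_affine_poly.
rewrite !hornerE /=.
apply/eqP; rewrite mulf_eq0; apply/orP; right.
have e : x0 ^+ 3 = d * x0 * y0 - y0 ^+ 3 - 1 by rewrite -on_affine; ring.
by apply/eqP; ring: e.
Qed.

(** A nonzero function with a rational zero is transcendental over the constants; this supplies the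
    first hypothesis of [ff_lift]. *)
Lemma ff_transcendental (A B : {poly {poly F}}) (p : {poly F}) :
    A.[y0%:P].[x0] = 0 -> B.[y0%:P].[x0] != 0 -> ff_eval H A != 0 ->
  (map_poly (ff_const H) p).[ff_eval H A / ff_eval H B] = 0 -> p = 0.
Proof.
exact: transcendental_quotient (ff_evalC H) ff_eval_specialize.
Qed.

End Specialization.

(** Transcendence of [xi] embeds F[x] into [L], hence F(x) as well; the relation then says that
    [ups] is a root of the cubic that defines y. *)
Lemma ff_lift (L : fieldType) (iota : {rmorphism F -> L}) (xi ups : L) :
    (forall p, (map_poly iota p).[xi] = 0 -> p = 0) ->
    xi ^+ 3 + ups ^+ 3 + 1 = iota d * xi * ups ->
  exists f : {rmorphism K -> L},
    [/\ forall c, f (ff_const H c) = iota c, f (ff_x H) = xi & f (ff_y H) = ups].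
Proof.
move=> transc rel.
have cxi : commr_rmorph iota xi by move=> a; apply: mulrC.
have inj : injective (horner_morph cxi).
  by apply: raddf_inj => p; apply: transc.
have [g gE] := fraction_universal inj.
have gC (p : {poly F}) : g (tofrac p) = (map_poly iota p).[xi] by rewrite gE.
have hroot : root (map_poly g (hessian_affine d)) ups.
  apply/rootP; rewrite /hessian_affine rmorphD rmorphB /=.
  rewrite map_polyXn map_polyZ map_polyC /= map_polyX !hornerE !gC.
  rewrite rmorphD rmorph1 /= map_polyZ map_polyX map_polyXn !hornerE /=.
  have e : xi ^+ 3 = iota d * xi * ups - ups ^+ 3 - 1 by rewrite -rel; ring.
  by ring: e.
have [f fE] := qfpoly_universal (hessian_affine_irreducible H) hroot.
exists f; split.
- move=> c; rewrite ff_constE /ff_ratfun -[RHS](hornerC _ xi) -map_polyC.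
  by rewrite -gC -[RHS](hornerC _ ups) -map_polyC -fE.
- by rewrite -[LHS]/(f (in_qpoly _ _)) fE map_polyC hornerC /= gC map_polyX hornerX.
- by rewrite -[LHS]/(f (in_qpoly _ _)) fE map_polyX hornerX.
Qed.

Lemma ff_morph_ext (L : fieldType) (f g : {rmorphism K -> L}) :
    (forall c, f (ff_const H c) = g (ff_const H c)) ->
    f (ff_x H) = g (ff_x H) -> f (ff_y H) = g (ff_y H) ->
  f =1 g.
Proof.
move=> ec ex ey; apply: ff_ind => // [a b ea eb|a b ea eb|a ea].
- by rewrite !rmorphD ea eb.
- by rewrite !rmorphM ea eb.
- by rewrite !fmorphV ea.
Qed.

End FunctionFieldMorphisms.

(** * Simple extensions *)

Section ExtensionDegree.
Variables (K L : fieldType) (f : {rmorphism K -> L}) (m : {poly K}) (x : L).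
Hypotheses (m_irr : irreducible_poly m) (mx0 : root (map_poly f m) x).

Definition simple_elt (z : L) := exists g : {poly K}, z = (map_poly f g).[x].

Lemma simple_elt_base (c : K) : simple_elt (f c).
Proof. by exists c%:P; rewrite map_polyC hornerC. Qed.

Lemma simple_elt_gen : simple_elt x.
Proof. by exists 'X; rewrite map_polyX hornerX. Qed.

Lemma simple_eltD (a b : L) : simple_elt a -> simple_elt b -> simple_elt (a + b).
Proof. by move=> [g ->] [h ->]; exists (g + h); rewrite rmorphD hornerD. Qed.

Lemma simple_eltN (a : L) : simple_elt a -> simple_elt (- a).
Proof. by move=> [g ->]; exists (- g); rewrite rmorphN hornerN. Qed.

Lemma simple_eltM (a b : L) : simple_elt a -> simple_elt b -> simple_elt (a * b).
Proof. by move=> [g ->] [h ->]; exists (g * h); rewrite rmorphM hornerM. Qed.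

(** If the irreducible [m] did not divide [g], the two would be coprime, and evaluating a Bezout
    relation at their common root [x] would give 1 = 0. *)
Lemma simple_elt_root_dvd (g : {poly K}) : root (map_poly f g) x -> m %| g.
Proof.
move=> gx0; apply/negPn; rewrite -irreducible_poly_coprime //.
apply/negP => /Bezout_eq1_coprimepP [[a b] /= e].
have := congr1 (fun p => (map_poly f p).[x]) e.
rewrite rmorph1 rmorphD !rmorphM /= !hornerE (rootP gx0) (rootP mx0) !mulr0 addr0.
by move/eqP; rewrite eq_sym oner_eq0.
Qed.

(** The Bezout cofactor of [g] modulo [m] takes the inverse value at [x]. The zero element is
    covered by the convention that its inverse is 0. *)
Lemma simple_eltV (a : L) : simple_elt a -> simple_elt a^-1.
Proof.
move=> [g ->]; have [->|g0] := eqVneq (map_poly f g).[x] 0.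
  by rewrite invr0 -(rmorph0 f); apply: simple_elt_base.
have : coprimep m g.
  rewrite irreducible_poly_coprime //; apply: contra_neqN g0 => /dvdpP[q ->].
  by rewrite rmorphM hornerM (rootP mx0) mulr0.
move=> /Bezout_eq1_coprimepP [[s t] /= e]; exists t.
apply: (mulIf g0); rewrite mulVf // -hornerM -rmorphM.
have := congr1 (fun p => (map_poly f p).[x]) e.
by rewrite rmorph1 rmorphD !rmorphM /= !hornerE (rootP mx0) mulr0 add0r.
Qed.

(** The powers of [x] below the degree of [m] form the basis; the coordinates of the value of [g] at
    [x] are the coefficients of [g %% m]. *)
Lemma simple_extension_degree :
  (forall z, simple_elt z) -> extension_degree f (size m).-1.
Proof.
move=> gen; exists (fun i => x ^+ i) => z.
have m0 : m != 0 by apply: irredp_neq0.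
have [g ->] := gen z.
(* A coordinate vector is turned into a polynomial so that division applies; the default 0 is never
   reached below the bound. *)
have eval_ffun (c : {ffun 'I_(size m).-1 -> K}) :
    \sum_i f (c i) * x ^+ i
      = (map_poly f (\poly_(i < (size m).-1)
                       (if insub i is Some j then c j else 0))).[x].
  rewrite (@horner_coef_wide _ (size m).-1); last first.
    by rewrite size_map_poly size_poly.
  apply: eq_bigr => i _; rewrite coef_map coef_poly ltn_ord /=.
  by case: insubP => [j _ /val_inj->|]; rewrite ?ltn_ord.
exists [ffun i : 'I_(size m).-1 => (g %% m)`_i]; split.
  rewrite eval_ffun.
  have -> : \poly_(i < (size m).-1)
      (if insub i is Some j then [ffun i : 'I_(size m).-1 => (g %% m)`_i] j else 0)
      = g %% m.
    apply/polyP => i; rewrite coef_poly; case: ltnP => [lt_i|le_i].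
      by case: insubP => [j _ ej|]; rewrite ?ffunE ?lt_i // ej.
    rewrite nth_default // (leq_trans _ le_i) // -ltnS prednK ?size_poly_gt0 //.
    by rewrite ltn_modp.
  rewrite {1}(divp_eq g m) rmorphD rmorphM /= hornerD hornerM (rootP mx0).
  by rewrite mulr0 add0r.
move=> c; rewrite eval_ffun; set h := \poly_(i < _) _ => e.
(* Uniqueness: [h] has the same value as [g] at [x] and is smaller than [m], so it is the remainder
   of [g]. *)
have : m %| g - h.
  apply: simple_elt_root_dvd; apply/rootP.
  by rewrite rmorphB hornerD hornerN e subrr.
move=> /modp_eq0P; rewrite modpD modpN => /eqP; rewrite subr_eq0 => /eqP {}e.
apply/ffunP => i; rewrite ffunE e modp_small.
  by rewrite coef_poly ltn_ord; case: insubP => [j _ /val_inj->|]; rewrite ?ltn_ord.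
by rewrite (leq_ltn_trans (size_poly _ _)) // prednK ?size_poly_gt0.
Qed.

End ExtensionDegree.

(** * The map on points *)

Lemma forall_ord3 (P : 'I_3 -> Prop) : P iX -> P iY -> P iZ -> forall i, P i.
Proof.
move=> PX PY PZ [[|[|[|n]]] lt_n] //.
- by rewrite (_ : Ordinal lt_n = iX) //; apply: val_inj.
- by rewrite (_ : Ordinal lt_n = iY) //; apply: val_inj.
- by rewrite (_ : Ordinal lt_n = iZ) //; apply: val_inj.
Qed.

Definition AGM_value (L : fieldType) (eta x y z : L) : 3.-tuple L :=
  [tuple eta * (x * y * z);
         x ^+ 2 * z + x * y ^+ 2 + y * z ^+ 2;
         x ^+ 2 * y + x * z ^+ 2 + y ^+ 2 * z].

Lemma hessian_form_eval (L : fieldType) (c : L) (v : 'I_3 -> L) :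
  (hessian_form c).@[v]
    = v iX ^+ 3 + v iY ^+ 3 + v iZ ^+ 3 - c * (v iX * v iY * v iZ).
Proof.
by rewrite /hessian_form mevalB !mevalD mevalZ !rmorphXn /= !mevalM !mevalXU.
Qed.

Lemma in_curve_ideal_eval (L : fieldType) (c : L) (p : {mpoly L[3]})
    (v : 'I_3 -> L) :
  in_curve_ideal c p -> (hessian_form c).@[v] = 0 -> p.@[v] = 0.
Proof. by move=> [q ->] e; rewrite mevalM e mulr0. Qed.

Lemma in_curve_ideal0 (L : fieldType) (c : L) : in_curve_ideal c 0.
Proof. by exists 0; rewrite mul0r. Qed.

Section AGMMap.
Variables (F : fieldType) (eta : F).

Lemma eval_AGM_map (L : fieldType) (iota : {rmorphism F -> L}) (P : 3.-tuple L) :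
  eval_triple (base_change iota (AGM_map eta)) P
    = AGM_value (iota eta) (tnth P iX) (tnth P iY) (tnth P iZ).
Proof.
apply: eq_from_tnth; apply: forall_ord3; rewrite !tnth_mktuple.
- rewrite /= map_mpolyZ !rmorphM /= !map_mpolyX.
  by rewrite mevalZ !mevalM !mevalXU.
- rewrite /= !(rmorphD, rmorphM) /= !map_mpolyX.
  by rewrite !mevalXU.
- rewrite /= !(rmorphD, rmorphM) /= !map_mpolyX.
  by rewrite !mevalXU.
Qed.

Lemma AGM_map_homog : homog_triple (AGM_map eta).
Proof.
have hX i : ('X_i : {mpoly F[3]}) \is 1.-homog by rewrite dhomogX /= mdeg1.
have hX2 i : ('X_i ^+ 2 : {mpoly F[3]}) \is 2.-homog.
  exact: (dhomogMn 2 (hX i)).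
have h3 i j : ('X_i ^+ 2 * 'X_j : {mpoly F[3]}) \is 3.-homog.
  exact: dhomogM (hX2 i) (hX j).
have h3' i j : ('X_i * 'X_j ^+ 2 : {mpoly F[3]}) \is 3.-homog.
  exact: dhomogM (hX i) (hX2 j).
exists 3; apply: forall_ord3 => /=.
- by apply: dhomogZ; apply: (dhomogM (dhomogM (hX iX) (hX iY)) (hX iZ)).
- by rewrite !rpredD.
- by rewrite !rpredD.
Qed.

Lemma base_change_homog (L : fieldType) (iota : {rmorphism F -> L})
    (f : form_triple F) :
  homog_triple f -> homog_triple (base_change iota f).
Proof.
move=> [e he]; exists e => i; rewrite tnth_mktuple.
apply/dhomogP => m; rewrite mcoeff_msupp => hm.
apply: (dhomog_mf (he i)); rewrite mcoeff_msupp; apply: contra_neq hm => hm.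
by rewrite mcoeff_map_mpoly hm; apply: (rmorph0 iota).
Qed.

Lemma maps_to_eval (L : fieldType) (iota : {rmorphism F -> L})
    (H : hessian_curve F) (f : form_triple F) (P : 3.-tuple L) :
    homog_triple f -> proj_coords (eval_triple (base_change iota f) P) ->
  maps_to iota H f P (eval_triple (base_change iota f) P).
Proof.
move=> hf nz; exists (base_change iota f); split=> //.
- exact: base_change_homog.
- by move=> i j; rewrite [X in X - _]mulrC mulrC subrr; apply: in_curve_ideal0.
- by move=> i j; rewrite mulrC.
Qed.

Hypothesis eta_neq0 : eta != 0.

(** A common zero has xyz = 0. Once one coordinate vanishes, the second form is a single monomial in
    the other two and kills another; the curve equation then says that the cube of the last one is
    0. *)
Lemma AGM_map_everywhere_defined (H : hessian_curve F) :
  everywhere_defined H (AGM_map eta).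
Proof.
move=> L iota P [[i Pi] onH]; rewrite eval_AGM_map.
have eta0 : iota eta != 0 by rewrite fmorph_eq0.
move: onH; rewrite hessian_form_eval.
set x := tnth P iX; set y := tnth P iY; set z := tnth P iZ => onH.
case: (eqVneq (x * y * z) 0) => [xyz0|nz]; last first.
  by exists iX; rewrite /= mulf_neq0.
case: (eqVneq (x ^+ 2 * z + x * y ^+ 2 + y * z ^+ 2) 0) => [p0|nz].
  2: by exists iY.
case: (eqVneq (x ^+ 2 * y + x * z ^+ 2 + y ^+ 2 * z) 0) => [q0|nz].
  2: by exists iZ.
exfalso; move: onH p0 q0; rewrite xyz0 mulr0 subr0.
have cube0 (a : L) : a ^+ 3 = 0 -> a = 0 by move/eqP; rewrite expf_eq0 => /eqP.
have all0 : x = 0 -> y = 0 -> z = 0 -> False.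
  move=> x0 y0 z0; move: i Pi.
  by apply: forall_ord3; rewrite -/x -/y -/z ?x0 ?y0 ?z0 eqxx.
move/eqP: xyz0; rewrite !mulf_eq0 -orbA => /or3P[] /eqP e; rewrite e.
- rewrite !(mul0r, expr0n, add0r) /= ?mul0r ?add0r => s /eqP.
  rewrite mulf_eq0 expf_eq0 => /orP[] /eqP e' _; move: s; rewrite e' expr0n /=.
    by rewrite add0r => /cube0 /(all0 e e').
  by rewrite addr0 => /cube0 h; apply: all0.
- rewrite !(mul0r, mulr0, expr0n, add0r, addr0) /= ?mulr0 ?mul0r ?addr0 => s /eqP.
  rewrite mulf_eq0 expf_eq0 => /orP[] /eqP e' _; move: s; rewrite e' expr0n /=.
    by rewrite add0r => /cube0 h; apply: all0.
  by rewrite addr0 => /cube0 h; apply: all0.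
- rewrite !(mul0r, mulr0, expr0n, add0r, addr0) /= ?mulr0 ?mul0r ?addr0 ?add0r.
  move=> s /eqP.
  rewrite mulf_eq0 expf_eq0 => /orP[] /eqP e' _; move: s; rewrite e' expr0n /=.
    by rewrite add0r => /cube0 h; apply: all0.
  by rewrite addr0 => /cube0 h; apply: all0.
Qed.

Variables H1 H2 : hessian_curve F.
Local Notation d := (hcoef H1).
Local Notation d' := (hcoef H2).
Hypothesis eta_cube : eta ^+ 3 = d ^+ 2 + 3%:R * d + 9%:R.
Hypothesis eta_coef : eta * d' = d + 6%:R.

(** Since p q = a s + (x^3 y^3 + y^3 z^3 + z^3 x^3) + 3 a^2, the cofactor is x^3 y^3 + y^3 z^3 + z^3
    x^3 - c a^2. The ring is arbitrary because the identity is used for forms, for points and in the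
    function field. *)
Lemma AGM_image_equation (R : comNzRingType) (e c c' x y z : R) :
    e ^+ 3 = c ^+ 2 + 3%:R * c + 9%:R -> e * c' = c + 6%:R ->
  let a := x * y * z in
  let p := x ^+ 2 * z + x * y ^+ 2 + y * z ^+ 2 in
  let q := x ^+ 2 * y + x * z ^+ 2 + y ^+ 2 * z in
  let s := x ^+ 3 + y ^+ 3 + z ^+ 3 in
  (e * a) ^+ 3 + p ^+ 3 + q ^+ 3 - c' * (e * a * p * q)
    = (p * q - a * s - c * a ^+ 2 - 3%:R * a ^+ 2) * (s - c * a).
Proof.
move=> e3 ec a p q s.
have -> : c' * (e * a * p * q) = (e * c') * (a * p * q) by ring.
rewrite exprMn e3 ec /s /p /q /a; ring.
Qed.

Lemma AGM_map_rational : is_rational_map H1 H2 (AGM_map eta).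
Proof.
split; first exact: AGM_map_homog.
  (* The point (1 : -1 : 0) lies on every Hessian curve, and the second form takes the value 1
     there. *)
  exists iY => hI; pose v : 'I_3 -> F := tnth [tuple 1; -1; 0].
  have := in_curve_ideal_eval (v := v) hI; rewrite hessian_form_eval.
  rewrite !(mevalD, mevalM) !mevalXU.
  have [-> -> ->] : [/\ v iX = 1, v iY = -1 & v iZ = 0] by [].
  move=> h; have /eqP : 1 * 1 * 0 + 1 * (-1 * -1) + -1 * (0 * 0) = 0 :> F.
    by apply: h; ring.
  by rewrite (_ : _ + _ = 1) ?oner_eq0 //; ring.
pose x : {mpoly F[3]} := 'X_iX; pose y : {mpoly F[3]} := 'X_iY.
pose z : {mpoly F[3]} := 'X_iZ.
pose C : {rmorphism F -> {mpoly F[3]}} := @mpolyC 3 F.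
have e3 : C eta ^+ 3 = C d ^+ 2 + 3%:R * C d + 9%:R.
  by rewrite -!rmorphXn eta_cube !rmorphD rmorphM !rmorph_nat.
have ed : C eta * C d' = C d + 6%:R.
  by rewrite -rmorphM eta_coef rmorphD rmorph_nat.
have := AGM_image_equation x y z e3 ed.
(* The quotient is left to unification with the cofactor in [AGM_image_equation]. *)
move=> h; eexists.
rewrite /hessian_form comp_mpolyB !comp_mpolyD comp_mpolyZ.
rewrite !rmorphXn !rmorphM /= !comp_mpolyXU /= -!mul_mpolyC.
exact: h.
Qed.

Lemma AGM_map_morphism : is_morphism H1 H2 (AGM_map eta).
Proof.
split=> [|L iota P onP]; first exact: AGM_map_rational.
have nz := AGM_map_everywhere_defined onP.
exists (eval_triple (base_change iota (AGM_map eta)) P); split.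
  split=> //; rewrite eval_AGM_map hessian_form_eval /=.
  have := onP.2; rewrite hessian_form_eval.
  set x := tnth P iX; set y := tnth P iY; set z := tnth P iZ => onH.
  have e3 : iota eta ^+ 3 = iota d ^+ 2 + 3%:R * iota d + 9%:R.
    by rewrite -!rmorphXn eta_cube 2!rmorphD rmorphM !rmorph_nat.
  have ed : iota eta * iota d' = iota d + 6%:R.
    by rewrite -rmorphM eta_coef rmorphD rmorph_nat.
  by rewrite (AGM_image_equation x y z e3 ed) onH mulr0.
by apply: maps_to_eval nz; apply: AGM_map_homog.
Qed.

Lemma AGM_map_origin :
  maps_to idfun H1 (AGM_map eta) (hessian_origin F) (hessian_origin F).
Proof.
(* The forms reproduce the triple (0, -1, 1) exactly, with no scalar factor. *)
have e : eval_triple (base_change idfun (AGM_map eta)) (hessian_origin F)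
    = hessian_origin F.
  rewrite eval_AGM_map; apply: val_inj.
  by rewrite /= ?/tnth /=; congr [:: _; _; _]; ring.
rewrite -[X in maps_to _ _ _ _ X]e; apply: maps_to_eval; first exact: AGM_map_homog.
by rewrite e; exists iZ; rewrite oner_eq0.
Qed.

End AGMMap.

(** * The degree *)

Section CyclicCoordinates.
Variables (L : fieldType) (x y : L).
Hypotheses (x0 : x != 0) (y0 : y != 0).
Let p := x ^+ 2 + x * y ^+ 2 + y.
Let q := x ^+ 2 * y + x + y ^+ 2.

(** The elementary symmetric functions of x, y/x, 1/y are q/(xy), p/(xy) and 1. *)
Lemma cyclic_cubic_factor (z : L) :
  z ^+ 3 - q / (x * y) * z ^+ 2 + p / (x * y) * z - 1
    = (z - x) * (z - y / x) * (z - y^-1).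
Proof. by rewrite /q /p; field; rewrite x0 y0. Qed.

(* Given [x], the pair (y / x, 1 / y) is determined up to order by its sum and
   product; the equation of the curve is not symmetric in the pair and
   therefore separates the two. *)
Lemma cyclic_y_expr (c : L) :
    x != y / x -> x != y^-1 -> x ^+ 3 + y ^+ 3 + 1 = c * x * y ->
  let r := q / (x * y) - x in
  y = x * (c + 1 - r * (x ^+ 2 + x^-1)) / (x * r - x ^+ 2 - x^-1).
Proof.
move=> n2 n3 e r.
have D0 : x * r - x ^+ 2 - x^-1 != 0.
  (* With r the sum of y/x and 1/y, and 1/x their product, the denominator factors, so it vanishes
     only when x equals one of the two. *)
  have -> : x * r - x ^+ 2 - x^-1 = - ((x - y / x) * (x - y^-1)).
    by rewrite /r /q; field; rewrite x0 y0.
  by rewrite oppr_eq0 mulf_neq0 // subr_eq0.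
have -> : c = (x ^+ 3 + y ^+ 3 + 1) / (x * y) by rewrite e; field; rewrite x0 y0.
apply: (mulIf D0); rewrite mulfVK //.
by rewrite /r /q; field; rewrite x0 y0.
Qed.

(** The pair (y/x, 1/x) consists of the affine coordinates of (Y : Z : X), and the curve equation is
    invariant under this cyclic shift. *)
Lemma cyclic_curve (c : L) :
  x ^+ 3 + y ^+ 3 + 1 = c * x * y ->
  (y / x) ^+ 3 + x^-1 ^+ 3 + 1 = c * (y / x) * x^-1.
Proof.
move=> e; have -> : (y / x) ^+ 3 + x^-1 ^+ 3 + 1 = (x ^+ 3 + y ^+ 3 + 1) / x ^+ 3.
  by field.
by rewrite e; field.
Qed.

(** Under the shift p, q and xy all acquire the same factor 1/x^3, which cancels in the affine
    coordinates of the image. *)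
Lemma cyclic_p : (y / x) ^+ 2 + y / x * x^-1 ^+ 2 + x^-1 = p / x ^+ 3.
Proof. by rewrite /p; field. Qed.

Lemma cyclic_q : (y / x) ^+ 2 * x^-1 + y / x + x^-1 ^+ 2 = q / x ^+ 3.
Proof. by rewrite /q; field. Qed.

Lemma cyclic_xy : y / x * x^-1 = x * y / x ^+ 3.
Proof. by field. Qed.

Hypothesis q0 : q != 0.

Lemma AGM_affine_curve (e c c' : L) :
    e ^+ 3 = c ^+ 2 + 3%:R * c + 9%:R -> e * c' = c + 6%:R ->
    x ^+ 3 + y ^+ 3 + 1 = c * x * y ->
  (e * (x * y) / q) ^+ 3 + (p / q) ^+ 3 + 1 = c' * (e * (x * y) / q) * (p / q).
Proof.
move=> e3 ec h; have := AGM_image_equation x y 1 e3 ec.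
rewrite /= !expr1n !mulr1 h -[c * x * y]mulrA subrr mulr0 -/p -/q => /eqP.
rewrite subr_eq0 => /eqP h'.
have -> : (e * (x * y) / q) ^+ 3 + (p / q) ^+ 3 + 1
    = ((e * (x * y)) ^+ 3 + p ^+ 3 + q ^+ 3) / q ^+ 3 by field.
rewrite h'; by field.
Qed.

End CyclicCoordinates.

(** * The pullback, the cyclic endomorphism and the degree of the extension *)

Section Degree.
Variables (F : fieldType) (eta : F) (H1 H2 : hessian_curve F).
Local Notation d := (hcoef H1).
Local Notation d' := (hcoef H2).
Local Notation K1 := (function_field H1).
Local Notation K2 := (function_field H2).
Hypothesis eta_neq0 : eta != 0.
Hypothesis eta_cube : eta ^+ 3 = d ^+ 2 + 3%:R * d + 9%:R.
Hypothesis eta_coef : eta * d' = d + 6%:R.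

Let x := ff_x H1.
Let y := ff_y H1.
Let e := ff_const H1 eta.
Let p := x ^+ 2 + x * y ^+ 2 + y.
Let q := x ^+ 2 * y + x + y ^+ 2.

Lemma ff_eval_neq0 (G : {poly {poly F}}) (u v : F) :
  u ^+ 3 + v ^+ 3 + 1 = d * u * v -> G.[v%:P].[u] != 0 -> ff_eval H1 G != 0.
Proof. by move=> on; apply: contra_neq; apply: ff_eval_specialize. Qed.

(** Functions are tested at two rational points: the identity (0, -1), a zero of x, and (-1, 0), a
    zero of y. *)
Let origin_on : 0 ^+ 3 + (-1) ^+ 3 + 1 = d * 0 * -1.
Proof. by ring. Qed.

Let origin'_on : (-1) ^+ 3 + 0 ^+ 3 + 1 = d * -1 * 0.
Proof. by ring. Qed.

Lemma ff_x_neq0 : x != 0.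
Proof.
rewrite /x -ff_evalX; apply: (ff_eval_neq0 origin'_on).
by rewrite !hornerE oppr_eq0 oner_eq0.
Qed.

Lemma ff_y_neq0 : y != 0.
Proof.
rewrite /y -ff_evalY; apply: (ff_eval_neq0 origin_on).
by rewrite !hornerE oppr_eq0 oner_eq0.
Qed.

Let B : {poly {poly F}} := 'X%:P ^+ 2 * 'X + 'X%:P + 'X ^+ 2.

Let qE : q = ff_eval H1 B.
Proof. by rewrite /B !rmorphD rmorphM !rmorphXn ff_evalX ff_evalY. Qed.

Let B0 : B.[(-1)%:P].[0] != 0.
Proof.
suff -> : B.[(-1)%:P].[0] = 1 by rewrite oner_eq0.
by rewrite /B !hornerE /=; ring.
Qed.

Lemma AGM_denominator_neq0 : q != 0.
Proof. by rewrite qE; apply: (ff_eval_neq0 origin_on). Qed.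

Lemma ff_x_neq_quotient : x != y / x.
Proof.
have : x ^+ 2 - y != 0.
  have -> : x ^+ 2 - y = ff_eval H1 ('X%:P ^+ 2 - 'X).
    by rewrite rmorphB rmorphXn ff_evalX ff_evalY.
  apply: (ff_eval_neq0 origin'_on).
  suff -> : ('X%:P ^+ 2 - 'X).[0%:P].[-1] = 1 :> F by rewrite oner_eq0.
  by rewrite !hornerE /=; ring.
apply: contra_neq => h; apply/eqP; rewrite subr_eq0 expr2 {1}h.
by rewrite divfK ?ff_x_neq0.
Qed.

(** The image of x is transcendental because it is nonzero and vanishes at the identity, where q
    takes the value 1; the curve relation is the image equation divided by q^3. *)
Lemma AGM_pullback : exists f : {rmorphism K2 -> K1},
  [/\ forall c, f (ff_const H2 c) = ff_const H1 c,
      f (ff_x H2) = e * (x * y) / q & f (ff_y H2) = p / q].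
Proof.
have q0 := AGM_denominator_neq0.
apply: ff_lift.
- have eA : e * (x * y) = ff_eval H1 (eta%:P%:P * ('X%:P * 'X)).
    by rewrite !rmorphM ff_evalC ff_evalX ff_evalY.
  move=> r; rewrite eA qE; apply: (ff_transcendental origin_on) => //.
    by rewrite !hornerE /=; ring.
  rewrite -eA !mulf_neq0 ?ff_x_neq0 ?ff_y_neq0 //.
  by rewrite fmorph_eq0.
- have e3 : e ^+ 3 = ff_const H1 d ^+ 2 + 3%:R * ff_const H1 d + 9%:R.
    by rewrite -!rmorphXn eta_cube 2!rmorphD rmorphM !rmorph_nat.
  have ed : e * ff_const H1 d' = ff_const H1 d + 6%:R.
    by rewrite -rmorphM eta_coef rmorphD rmorph_nat.
  refine (AGM_affine_curve q0 e3 ed (ff_relation H1)).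
Qed.

(** Here y/x is transcendental because it is nonzero and vanishes at (-1, 0). *)
Lemma ff_cyclic : exists s : {rmorphism K1 -> K1},
  [/\ forall c, s (ff_const H1 c) = ff_const H1 c, s x = y / x & s y = x^-1].
Proof.
have x0 := ff_x_neq0; apply: ff_lift.
- move=> r; rewrite /x /y -ff_evalX -ff_evalY.
  apply: (ff_transcendental origin'_on); rewrite ?ff_evalY ?ff_y_neq0 //.
    by rewrite !hornerE.
  by rewrite !hornerE oppr_eq0 oner_eq0.
- refine (cyclic_curve x0 (ff_relation H1)).
Qed.

Lemma AGM_pullback_degree (f : {rmorphism K2 -> K1}) :
    (forall c, f (ff_const H2 c) = ff_const H1 c) ->
    f (ff_x H2) = e * (x * y) / q -> f (ff_y H2) = p / q ->
  extension_degree f 3.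
Proof.
move=> fc fx fy; have [s [sc sx sy]] := ff_cyclic.
have x0 := ff_x_neq0; have y0 := ff_y_neq0.
have q0 := AGM_denominator_neq0; have n12 := ff_x_neq_quotient.
have e0 : e != 0 by rewrite fmorph_eq0.
(* The endomorphism [s] runs through the cycle x, y/x, 1/y, so the single inequality x != y/x
   propagates to the other two pairs. *)
have s2 : s (y / x) = y^-1.
  by rewrite fmorph_div sx sy invf_div mulrA mulVf ?mul1r.
have s3 : s y^-1 = x by rewrite fmorphV sy invrK.
have n23 : y / x != y^-1 by rewrite -s2 -sx (inj_eq (fmorph_inj s)) sx.
have n31 : y^-1 != x by rewrite -s3 -{1}s2 (inj_eq (fmorph_inj s)).
have sp : s p = p / x ^+ 3.
  by rewrite 2!rmorphD rmorphM !rmorphXn sx sy cyclic_p.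
have sq : s q = q / x ^+ 3.
  by rewrite 2!rmorphD rmorphM !rmorphXn sx sy cyclic_q.
have sf z : s (f z) = f z.
  apply: (ff_morph_ext (f := s \o f) (g := f)) => [c||] /=.
  - by rewrite fc sc.
  - rewrite fx fmorph_div !rmorphM sc sq sx sy cyclic_xy //.
    by rewrite -/e [e * (_ / _)]mulrA cancel_right ?invr_eq0 ?expf_neq0.
  - by rewrite fy fmorph_div sp sq cancel_right ?invr_eq0 ?expf_neq0.
(* These are eta/xi and eta ups/xi, whose pullbacks are the first two symmetric functions of the
   cycle. *)
pose c1 := ff_const H2 eta / ff_x H2; pose c2 := c1 * ff_y H2.
have fc1 : f c1 = q / (x * y).
  by rewrite /c1 fmorph_div fc fx -/e invf_div mulrCA invfM mulVKf.
have fc2 : f c2 = p / (x * y).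
  by rewrite /c2 rmorphM fc1 fy mulrC mulrA divfK.
pose m := Poly [:: -1; c2; - c1; 1].
have sm : size m = 4%N by rewrite (PolyK (c := 0)) //= oner_eq0.
have mE z : (map_poly f m).[z] = (z - x) * (z - y / x) * (z - y^-1).
  rewrite -(cyclic_cubic_factor x0 y0) -/p -/q -fc1 -fc2.
  rewrite map_Poly_id0 ?rmorph0 // horner_Poly /= !rmorphN rmorph1.
  by ring.
(* A cubic is irreducible once it has no root. A root [r] would make [f r], which [s] fixes, one of
   x, y/x, 1/y, none of which [s] fixes. *)
have m_irr : irreducible_poly m.
  apply: cubic_irreducible => [|r]; first by rewrite sm.
  apply/negP => /rootP mr; have := mE (f r).
  rewrite horner_map mr rmorph0 => /esym/eqP.
  rewrite !mulf_eq0 !subr_eq0 -orbA => /or3P[]/eqP h; move: (sf r); rewrite h.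
  - by rewrite sx => /eqP; rewrite eq_sym (negPf n12).
  - by rewrite s2 => /eqP; rewrite eq_sym (negPf n23).
  - by rewrite s3 => /eqP; rewrite eq_sym (negPf n31).
have mx0 : root (map_poly f m) x by apply/rootP; rewrite mE subrr !mul0r.
have Sf := simple_elt_base f x; have Sx := simple_elt_gen f x.
have SD := @simple_eltD _ _ f x; have SN := @simple_eltN _ _ f x.
have SM := @simple_eltM _ _ f x; have SV := @simple_eltV _ _ f m x m_irr mx0.
have := simple_extension_degree m_irr mx0; rewrite sm; apply.
(* The closure facts in context leave the constants, which come from the base, and y, which
   [cyclic_y_expr] writes in terms of x and the base. *)
apply: ff_ind => // [c|]; first by rewrite -fc.
have Sc1 : simple_elt f x (q / (x * y)) by rewrite -fc1.
have Sd : simple_elt f x (ff_const H1 d) by rewrite -fc.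
have S1 : simple_elt f x 1 by rewrite -(rmorph1 f).
have n13 : x != y^-1 by rewrite eq_sym.
rewrite -/y (cyclic_y_expr x0 y0 n12 n13 (ff_relation H1)) -/q.
have Sr := SD _ _ Sc1 (SN _ Sx).
have Sx2 : simple_elt f x (x ^+ 2) by rewrite expr2; apply: SM.
have SVx := SV _ Sx.
have Sn := SM _ _ Sx (SD _ _ (SD _ _ Sd S1) (SN _ (SM _ _ Sr (SD _ _ Sx2 SVx)))).
have SD' := SD _ _ (SD _ _ (SM _ _ Sx Sr) (SN _ Sx2)) (SN _ SVx).
exact (SM _ _ Sn (SV _ SD')).
Qed.

End Degree.

(** * Nonconstancy and assembly of the isogeny *)

Lemma map_hessian_form (F L : fieldType) (iota : {rmorphism F -> L}) (c : F) :
  map_mpoly iota (hessian_form c) = hessian_form (iota c).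
Proof.
rewrite /hessian_form rmorphB !rmorphD !rmorphXn /= map_mpolyZ !rmorphM /=.
by rewrite !map_mpolyX.
Qed.

Lemma in_curve_ideal_map (F L : fieldType) (iota : {rmorphism F -> L}) (c : F)
    (p : {mpoly F[3]}) :
  in_curve_ideal c p -> in_curve_ideal (iota c) (map_mpoly iota p).
Proof.
by move=> [q ->]; exists (map_mpoly iota q); rewrite rmorphM /= map_hessian_form.
Qed.

Lemma map_mpoly_evalMC (F L : fieldType) (iota : {rmorphism F -> L})
    (p : {mpoly F[3]}) (c : F) (v : 'I_3 -> L) :
  (map_mpoly iota (p * c%:MP)).@[v] = (map_mpoly iota p).@[v] * iota c.
Proof. by rewrite rmorphM mevalM /= map_mpolyC mevalC. Qed.

Lemma in_curve_ideal_generic (F : fieldType) (H : hessian_curve F)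
    (p : {mpoly F[3]}) :
  in_curve_ideal (hcoef H) p ->
  (map_mpoly (ff_const H) p).@[tnth (generic_point H)] = 0.
Proof.
move=> hp; apply: (in_curve_ideal_eval (in_curve_ideal_map (ff_const H) hp)).
rewrite hessian_form_eval.
have [-> -> ->] : [/\ tnth (generic_point H) iX = ff_x H,
    tnth (generic_point H) iY = ff_y H & tnth (generic_point H) iZ = 1] by [].
by rewrite expr1n ff_relation mulr1 mulrA subrr.
Qed.

Lemma base_change_AGM_map (F L : fieldType) (iota : {rmorphism F -> L}) (eta : F) :
  base_change iota (AGM_map eta) = AGM_map (iota eta).
Proof.
apply: eq_from_tnth; apply: forall_ord3; rewrite tnth_mktuple.
- by rewrite /= map_mpolyZ !rmorphM /= !map_mpolyX.
- by rewrite /= !(rmorphD, rmorphM) /= !map_mpolyX.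
- by rewrite /= !(rmorphD, rmorphM) /= !map_mpolyX.
Qed.

(** The value at the identity forces a constant image to be proportional to (0, -1, 1). The first
    form would then vanish at the generic point, where it equals the nonzero function eta x y. *)
Lemma AGM_map_nonconstant (F : fieldType) (H : hessian_curve F) (eta : F) :
  eta != 0 -> nonconstant H (AGM_map eta).
Proof.
move=> eta0 L iota c [k ck] same.
(* The curve stays nonsingular over [L], so its function field over [L] is available. *)
have hL : iota (hcoef H) ^+ 3 != 27%:R.
  by rewrite -rmorphXn -(rmorph_nat iota) (inj_eq (fmorph_inj iota)) hcoefP.
pose HL := HessianCurve hL.
have sameO i j := in_curve_ideal_eval (v := tnth (hessian_origin L)) (same i j).
have [oX oY oZ] : [/\ tnth (hessian_origin L) iX = 0,
    tnth (hessian_origin L) iY = -1 & tnth (hessian_origin L) iZ = 1] by [].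
have onO : (hessian_form (iota (hcoef H))).@[tnth (hessian_origin L)] = 0.
  by rewrite hessian_form_eval oX oY oZ; ring.
have constE i : tnth [tuple (tnth c j)%:MP_[3] | j < 3] i = (tnth c i)%:MP.
  by rewrite tnth_mktuple.
have fE i (v : 3.-tuple L) : (tnth (base_change iota (AGM_map eta)) i).@[tnth v]
    = tnth (AGM_value (iota eta) (tnth v iX) (tnth v iY) (tnth v iZ)) i.
  by rewrite -eval_AGM_map [RHS]tnth_mktuple.
have eO i j : tnth (AGM_value (iota eta) 0 (-1) 1) i * tnth c j
    = tnth (AGM_value (iota eta) 0 (-1) 1) j * tnth c i.
  have := sameO i j onO; rewrite !constE mevalB !mevalM !mevalC !fE oX oY oZ.
  by move/eqP; rewrite subr_eq0 => /eqP.
have vO : AGM_value (iota eta) 0 (-1) 1 = hessian_origin L.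
  by apply: val_inj; rewrite /=; congr [:: _; _; _]; ring.
have cX : tnth c iX = 0.
  have := eO iX iY; rewrite vO oX oY mul0r mulN1r.
  by move/esym/eqP; rewrite oppr_eq0 => /eqP.
have cYZ : tnth c iZ = - tnth c iY.
  by have := eO iZ iY; rewrite vO oY oZ mul1r mulN1r => ->; rewrite opprK.
have cY : tnth c iY = 0.
  have := in_curve_ideal_generic (H := HL) (same iX iY).
  rewrite !constE cX base_change_AGM_map mpolyC0 mulr0 subr0.
  rewrite map_mpoly_evalMC.
  have -> : map_mpoly (ff_const HL) (tnth (AGM_map (iota eta)) iX)
      = tnth (base_change (ff_const HL) (AGM_map (iota eta))) iX.
    by rewrite tnth_mktuple.
  have -> : (tnth (base_change (ff_const HL) (AGM_map (iota eta))) iX).@[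
        tnth (generic_point HL)]
      = ff_const HL (iota eta) * (ff_x HL * ff_y HL * 1).
    by have := congr1 (fun t => tnth t iX)
         (eval_AGM_map (iota eta) (ff_const HL) (generic_point HL));
      rewrite [X in X = _]tnth_mktuple.
  move/eqP; rewrite mulr1 !mulf_eq0 !fmorph_eq0 (negPf eta0).
  by rewrite (negPf (ff_x_neq0 HL)) (negPf (ff_y_neq0 HL)) => /eqP.
by move: k ck; apply: forall_ord3; rewrite ?cYZ ?cY ?cX ?oppr0 eqxx.
Qed.

Lemma AGM_map_degree (F : fieldType) (eta : F) (H1 H2 : hessian_curve F) :
    eta != 0 -> eta ^+ 3 = hcoef H1 ^+ 2 + 3%:R * hcoef H1 + 9%:R ->
    eta * hcoef H2 = hcoef H1 + 6%:R ->
  has_degree H1 H2 (AGM_map eta) 3.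
Proof.
move=> eta0 e3 ed; have [f [fc fx fy]] := AGM_pullback eta0 e3 ed.
exists f; split; last exact: AGM_pullback_degree fx fy.
have q0 := AGM_denominator_neq0 H1.
rewrite /is_pullback eval_AGM_map.
have [-> -> ->] : [/\ tnth (generic_point H1) iX = ff_x H1,
    tnth (generic_point H1) iY = ff_y H1 & tnth (generic_point H1) iZ = 1] by [].
set v := AGM_value _ _ _ _.
have vX : tnth v iX = ff_const H1 eta * (ff_x H1 * ff_y H1 * 1) by [].
have vY : tnth v iY
    = ff_x H1 ^+ 2 * 1 + ff_x H1 * ff_y H1 ^+ 2 + ff_y H1 * 1 ^+ 2 by [].
have vZ : tnth v iZ
    = ff_x H1 ^+ 2 * ff_y H1 + ff_x H1 * 1 ^+ 2 + ff_y H1 ^+ 2 * 1 by [].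
by rewrite vX vY vZ !expr1n !mulr1.
Qed.

Lemma AGM_map_isogeny (F : fieldType) (eta : F) (H1 H2 : hessian_curve F) :
    eta != 0 -> eta ^+ 3 = hcoef H1 ^+ 2 + 3%:R * hcoef H1 + 9%:R ->
    eta * hcoef H2 = hcoef H1 + 6%:R ->
  is_n_isogeny 3 H1 H2 (AGM_map eta).
Proof.
move=> eta0 e3 ed; split; last exact: AGM_map_degree.
split; first exact: AGM_map_morphism.
- exact: AGM_map_nonconstant.
- exact: AGM_map_origin.
Qed.

(** * AGM edges over a finite field *)

Lemma three_neq0 (p m : nat) (F : finFieldType) :
  prime p -> (5 <= p)%N -> #|F| = (p ^ m)%N -> 3%:R != 0 :> F.
Proof.
move=> p_pr p5 cardF; apply/eqP => e3.
have ch3 : 3 \in [pchar F] by rewrite inE /= e3 eqxx.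
have := card_finPcharP cardF p_pr.
by rewrite (pcharf_eq ch3) inE => /eqP ep; rewrite ep in p5.
Qed.

Theorem theorem4p2 (p m q : nat) (F : finFieldType)
    (p_prime : prime p) (p_ge5 : (5 <= p)%N) (m_ge1 : (1 <= m)%N)
    (q_def : q = (p ^ m)%N) (q_mod3 : q = 2 %[mod 3]) (card_F : #|F| = q)
    (u v u' v' : F) (edge : AGM_edge (u, v) (u', v')) :
  let rho := u / v in
  let rho' := u' / v' in
  let A := 9%:R * (rho ^+ 2 + rho + 1) in
  let D := 3%:R * (rho + 2%:R) in
  let eta := 3%:R * v' / v in
  [/\ eta != 0,
      eta ^+ 3 = A,
      D / eta = 3%:R * rho'
    & exists (nonsing : (3%:R * rho) ^+ 3 != 27%:R)
             (nonsing' : (3%:R * rho') ^+ 3 != 27%:R),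
        let H := HessianCurve nonsing in
        let H' := HessianCurve nonsing' in
        everywhere_defined H (AGM_map eta) /\
        is_n_isogeny 3 H H' (AGM_map eta)].
Proof.
have three0 : 3%:R != 0 :> F.
  by apply: (three_neq0 (m := m) p_prime p_ge5); rewrite card_F.
case: edge => [[v0 uv] [v'0 uv'] eu' ev'] rho rho' A D eta.
rewrite /= in v0 uv v'0 uv' eu' ev'.
have eta0 : eta != 0 by rewrite /eta !mulf_neq0 ?invr_eq0.
have eta3 : eta ^+ 3 = A.
  rewrite /eta !exprMn exprVn ev' /A /rho; field; rewrite v0 three0 //.
have etaD : D / eta = 3%:R * rho'.
  rewrite /eta /D /rho /rho' eu'; field; rewrite v0 v'0 three0 //.
(* Clearing denominators turns (3a/b)^3 = 27 into 27 (a^3 - b^3) = 0, and 3 is invertible; this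
   covers both ends of the edge. *)
have nonsingular (a b : F) :
    b != 0 -> a ^+ 3 != b ^+ 3 -> (3%:R * (a / b)) ^+ 3 != 27%:R.
  move=> b0; apply: contra_neq => h.
  have h3 : 3%:R ^+ 3 * (a ^+ 3 - b ^+ 3) = 0 :> F.
    have -> : 3%:R ^+ 3 * (a ^+ 3 - b ^+ 3)
        = ((3%:R * (a / b)) ^+ 3 - 27%:R) * b ^+ 3.
      by field.
    by rewrite h subrr mul0r.
  move/eqP: h3; rewrite mulf_eq0 expf_eq0 (negPf three0) andbF subr_eq0.
  by move/eqP.
split=> //; exists (nonsingular u v v0 uv), (nonsingular u' v' v'0 uv') => H H'.
split; first exact: AGM_map_everywhere_defined.
(* In terms of d = 3 rho, [A] is d^2 + 3 d + 9 and [D] is d + 6. *)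
apply: AGM_map_isogeny => //=.
  by rewrite eta3 /A; ring.
by rewrite -etaD mulrCA divff // /D; ring.
Qed.
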